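(* Fix an odd integer $n$. There exists $p_0=p_0(n)>0$ such that for all $p\in(0,p_0)$, the function $\mathrm{Maj}_n$ is the unique maximizer of $\Phi_p$ over unbiased Boolean functions $f:\{-1,1\}^n\to\{-1,1\}$; i.e., $$\Phi_p(\mathrm{Maj}_n)>\Phi_p(f)\qquad\text{for all unbiased } f\neq \mathrm{Maj}_n.$$
   Context: The hypercube $\{-1,1\}^n$ carries the uniform probability measure. A Boolean function is a map $f:\{-1,1\}^n\to\{-1,1\}$; it is unbiased if $\mathbb{E}[f]=0$. For odd $n$, $\mathrm{Maj}_n(x)=\operatorname{sgn}(x_1+\cdots+x_n)$, i.e. $1$ if a majority of the coordinates equal $1$ and $-1$ otherwise. Every $f$ has a unique multilinear extension $f(z)=\sum_{S\subseteq[n]}\widehat f(S)\prod_{i\in S}z_i$, $z\in[-1,1]^n$, where $\widehat f(S)=\mathbb{E}[f(x)\prod_{i\in S}x_i]$ with $x$ uniform on $\{-1,1\}^n$. Erasure model: for $p\in(0,1)$, let $z\in\{-1,0,1\}^n$ be random with independent coordinates satisfying $\Pr[z_i=1]=\Pr[z_i=-1]=\tfrac p2$ and $\Pr[z_i=0]=1-p$. Define $\Phi_p(f):=\mathbb{E}_z\big[|f(z)|\big]$, where $f(z)$ is the multilinear extension of $f$ evaluated at $z$.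
   Formalization: As stated it is false: −Maj_n is unbiased and ties with Maj_n. Uniqueness is proved up to coordinate sign flips: strict inequality for unbiased f not of the form Maj_n(s_1x_1,…,s_nx_n), s_i=±1, and equality for f of that form. *)

(* Defs.v *)
From HB Require Import structures.
From mathcomp Require Import all_boot all_order all_algebra.

Set Implicit Arguments.
Unset Strict Implicit.
Unset Printing Implicit Defensive.

Import Order.TTheory GRing.Theory Num.Theory.
Local Open Scope ring_scope.

(* The two-point set {-1, 1} is encoded by bool: true stands for 1 and false
   for -1. *)
Definition cube (n : nat) := {ffun 'I_n -> bool}.
Definition boolfun (n : nat) := {ffun cube n -> bool}.

Definition sgn (R : pzRingType) (b : bool) : R := if b then 1 else -1.
Arguments sgn : clear implicits.

Section Defs.
Variables (R : realFieldType) (n : nat).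
Implicit Types (f : boolfun n) (S : {set 'I_n}) (p : R).

Definition expect (F : cube n -> R) : R := (\sum_(x : cube n) F x) / 2 ^+ n.

Definition unbiased f : Prop := expect (fun x => sgn R (f x)) = 0.

Definition fourier f S : R :=
  expect (fun x => sgn R (f x) * \prod_(i in S) sgn R (x i)).

Definition mlext f (z : 'I_n -> R) : R :=
  \sum_(S : {set 'I_n}) fourier f S * \prod_(i in S) z i.

(* A point of {-1, 0, 1}^n is encoded with None for an erased coordinate. *)
Definition tern := {ffun 'I_n -> option bool}.

Definition tern_val (t : option bool) : R := if t is Some b then sgn R b else 0.

Definition tern_prob p (t : option bool) : R :=
  if t is Some _ then p / 2 else 1 - p.

Definition erasure_prob p (z : tern) : R := \prod_(i < n) tern_prob p (z i).

Definition Phi p f : R :=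
  \sum_(z : tern) erasure_prob p z * `|mlext f (fun i => tern_val (z i))|.

End Defs.

Arguments unbiased R {n} f.
Arguments Phi {R n} p f.

Definition Maj (n : nat) : boolfun n :=
  [ffun x : cube n => 0 < \sum_(i < n) sgn int (x i)].

(* x |-> f(s_1 x_1, ..., s_n x_n) with s_i = -1 exactly when i \in S.
   The erasure distribution is symmetric in each coordinate, so Phi takes the
   same value at f and flip S f; for odd n, flip setT (Maj n) is -Maj_n. Hence
   a maximizer of Phi can be unique only up to these sign changes. *)
Definition flip (n : nat) (S : {set 'I_n}) (f : boolfun n) : boolfun n :=
  [ffun x : cube n => f [ffun i => x i (+) (i \in S)]].

(* Main.v *)
(** As [p] tends to 0, [Phi p f = p * (\sum_i |fourier f {i}|) + O(p^2)] for
    unbiased [f], since the points with at most one unerased coordinate carry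
    all the mass up to [O(p^2)]. After replacing [f] by a suitable [flip S f] the
    degree-one coefficients are nonnegative, and their sum is
    [E[f(x) (x_1 + ... + x_n)] <= E|x_1 + ... + x_n|]; as the sum of the [x_i]
    never vanishes for odd [n], equality holds only for the majority function.
    There are finitely many [f], so one threshold serves them all. *)
Require Import Defs.
From mathcomp Require Import all_boot all_order all_algebra.
From mathcomp Require Import ring lra.

Set Implicit Arguments.
Unset Strict Implicit.
Unset Printing Implicit Defensive.

Import Order.TTheory GRing.Theory Num.Theory.
Local Open Scope ring_scope.

(** * Signs, coordinate sums and majority *)

Lemma sgn_addb (R : pzRingType) (a b : bool) :
  sgn R (a (+) b) = (-1) ^+ b * sgn R a.
Proof. by case: a; case: b; rewrite /= ?expr0 ?expr1 ?mul1r ?mulN1r ?opprK. Qed.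

Lemma intr_sgn (R : pzRingType) (b : bool) : (sgn int b)%:~R = sgn R b.
Proof. by case: b; rewrite /= ?rmorphN1. Qed.

Lemma normr_sgn (R : realFieldType) (b : bool) : `|sgn R b| = 1.
Proof. by case: b; rewrite /= ?normrN normr1. Qed.

Definition coord_sum (R : realFieldType) (n : nat) (x : cube n) : R :=
  \sum_(i < n) sgn R (x i).

Lemma intr_coord_sum (R : realFieldType) (n : nat) (x : cube n) :
  (\sum_(i < n) sgn int (x i))%:~R = coord_sum R x.
Proof. by rewrite rmorph_sum; apply: eq_bigr => i _; exact: intr_sgn. Qed.

Lemma Maj_coord_sum (R : realFieldType) (n : nat) (x : cube n) :
  Maj n x = (0 < coord_sum R x).
Proof. by rewrite ffunE -intr_coord_sum ltr0z. Qed.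

(** The sum is [n] minus twice the number of coordinates equal to [false], hence the image of an odd
    integer in a field of characteristic zero. *)
Lemma coord_sum_neq0 (R : realFieldType) (n : nat) (x : cube n) :
  odd n -> coord_sum R x != 0.
Proof.
move=> n_odd.
have -> : coord_sum R x = n%:R - (\sum_(i < n) ~~ x i).*2%:R.
  rewrite -muln2 natrM natr_sum mulr_suml.
  rewrite -[n in n%:R](card_ord n) -sum1_card natr_sum -sumrB.
  by apply: eq_bigr => i _; case: (x i) => /=; ring.
rewrite subr_eq0 eqr_nat; apply: contraTneq n_odd => ->.
by rewrite odd_double.
Qed.

Lemma sgn_Maj_mul (R : realFieldType) (n : nat) (x : cube n) :
  sgn R (Maj n x) * coord_sum R x = `|coord_sum R x|.
Proof.
rewrite (Maj_coord_sum R).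
case: ltrP => [s_gt0|s_le0] /=; first by rewrite mul1r gtr0_norm.
by rewrite mulN1r ler0_norm.
Qed.

(** * Sign changes of coordinates *)

Definition flip_pt (n : nat) (S : {set 'I_n}) (x : cube n) : cube n :=
  [ffun i => x i (+) (i \in S)].

Lemma flip_ptK (n : nat) (S : {set 'I_n}) : involutive (flip_pt S).
Proof. by move=> x; apply/ffunP => i; rewrite !ffunE -addbA addbb addbF. Qed.

Lemma flipE (n : nat) (S : {set 'I_n}) (f : boolfun n) (x : cube n) :
  flip S f x = f (flip_pt S x).
Proof. by rewrite ffunE. Qed.

Lemma flipK (n : nat) (S : {set 'I_n}) : involutive (@flip n S).
Proof. by move=> f; apply/ffunP => x; rewrite !flipE flip_ptK. Qed.

Lemma expect_flip_pt (R : realFieldType) (n : nat) (S : {set 'I_n})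
    (F : cube n -> R) :
  expect (fun x => F (flip_pt S x)) = expect F.
Proof.
rewrite /expect; congr (_ / _); symmetry.
by apply: reindex_inj; apply: inv_inj; exact: flip_ptK.
Qed.

Lemma eq_expect (R : realFieldType) (n : nat) (F G : cube n -> R) :
  F =1 G -> expect F = expect G.
Proof. by move=> eFG; rewrite /expect (eq_bigr _ (fun x _ => eFG x)). Qed.

Lemma expectZ (R : realFieldType) (n : nat) (c : R) (F : cube n -> R) :
  expect (fun x => c * F x) = c * expect F.
Proof. by rewrite /expect -mulr_sumr mulrA. Qed.

(** Negating every coordinate preserves the expectation and negates the coordinate sum; as this sum
    is nonzero, the majority is negated too, so the expectation equals its own opposite. *)
Lemma unbiased_Maj (R : realFieldType) (n : nat) : odd n -> unbiased R (Maj n).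
Proof.
move=> n_odd.
suff E : expect (fun x => sgn R (Maj n x)) = - expect (fun x => sgn R (Maj n x)).
  by rewrite /unbiased; lra.
rewrite -[LHS](expect_flip_pt setT) -mulN1r -expectZ; apply: eq_expect => x.
have -> : Maj n (flip_pt setT x) = ~~ Maj n x.
  rewrite !(Maj_coord_sum R).
  have -> : coord_sum R (flip_pt setT x) = - coord_sum R x.
    rewrite -sumrN; apply: eq_bigr => i _.
    by rewrite ffunE inE sgn_addb expr1 mulN1r.
  by rewrite oppr_gt0 -leNgt [RHS]le_eqVlt (negPf (coord_sum_neq0 R x n_odd)).
by case: (Maj n x); rewrite /= ?mulr1 // mulN1r opprK.
Qed.

Lemma fourier_flip (R : realFieldType) (n : nat) (S T : {set 'I_n})
    (f : boolfun n) :
  fourier R (flip S f) T = (\prod_(i in T) (-1) ^+ (i \in S)) * fourier R f T.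
Proof.
rewrite /fourier -[LHS](expect_flip_pt S) -expectZ.
apply: eq_expect => x; rewrite flipE flip_ptK mulrCA -big_split /=.
by congr (_ * _); apply: eq_bigr => i _; rewrite ffunE sgn_addb.
Qed.

Definition flip_tern (n : nat) (S : {set 'I_n}) (z : tern n) : tern n :=
  [ffun i => omap (addb^~ (i \in S)) (z i)].

Lemma flip_ternK (n : nat) (S : {set 'I_n}) : involutive (flip_tern S).
Proof.
move=> z; apply/ffunP => i; rewrite !ffunE.
by case: (z i) => //= b; rewrite -addbA addbb addbF.
Qed.

(** Reindexing by [flip_tern S] preserves the erasure probabilities, and the signs it creates in
    each monomial match those of [fourier_flip]. *)
Lemma Phi_flip (R : realFieldType) (n : nat) (S : {set 'I_n}) (p : R)
    (f : boolfun n) :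
  Phi p (flip S f) = Phi p f.
Proof.
rewrite /Phi [RHS](reindex_inj (inv_inj (flip_ternK S))).
apply: eq_bigr => z _; congr (_ * _).
  by apply: eq_bigr => i _; rewrite ffunE; case: (z i).
congr (Num.norm _); apply: eq_bigr => T _; rewrite fourier_flip mulrAC mulrC -big_split /=.
congr (_ * _); apply: eq_bigr => i _; rewrite ffunE.
by case: (z i) => [b|] /=; rewrite ?mulr0 ?sgn_addb.
Qed.

(** * Degree-one Fourier coefficients *)

Definition level1_norm (R : realFieldType) (n : nat) (f : boolfun n) : R :=
  \sum_(i < n) `|fourier R f [set i]|.

Lemma sum_fourier_set1 (R : realFieldType) (n : nat) (f : boolfun n) :
  \sum_(i < n) fourier R f [set i] =
  expect (fun x => sgn R (f x) * coord_sum R x).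
Proof.
rewrite /fourier /expect -mulr_suml exchange_big /=; congr (_ / _).
apply: eq_bigr => x _; rewrite mulr_sumr.
by apply: eq_bigr => i _; rewrite big_set1.
Qed.

Lemma level1_norm_lt_Maj (R : realFieldType) (n : nat) (f : boolfun n) :
  odd n -> (forall S, f <> flip S (Maj n)) ->
  level1_norm R f < level1_norm R (Maj n).
Proof.
move=> n_odd f_neq.
(* Flipping exactly these coordinates makes every degree-one coefficient nonnegative. *)
pose S := [set i | fourier R f [set i] < 0].
have -> : level1_norm R f = \sum_(i < n) fourier R (flip S f) [set i].
  apply: eq_bigr => i _; rewrite fourier_flip big_set1 inE.
  by case: ltrP => h; rewrite /= ?mul1r ?mulN1r ?(ltr0_norm h) ?(ger0_norm h).
apply: (@lt_le_trans _ _ (\sum_(i < n) fourier R (Maj n) [set i])); last first.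
  by apply: ler_sum => i _; exact: ler_norm.
rewrite !sum_fourier_set1 /expect ltr_pM2r ?invr_gt0 ?exprn_gt0 ?ltr0n //.
have [x gx_neq] : exists x, flip S f x != Maj n x.
  apply/existsP; apply: contraT => /existsPn eq_fM; case: (f_neq S).
  rewrite -[LHS](flipK S); congr (flip S _); apply/ffunP => x.
  exact/eqP/negPn/eq_fM.
have le_norm y : sgn R (flip S f y) * coord_sum R y <= `|coord_sum R y|.
  by rewrite (le_trans (ler_norm _)) // normrM normr_sgn mul1r.
(* Strictness comes from the term at [x]: the two functions have opposite signs there and
   [coord_sum R x] is nonzero. *)
rewrite (bigD1 x) //= [ltRHS](bigD1 x) //=; apply: ltr_leD; last first.
  by apply: ler_sum => y _; rewrite sgn_Maj_mul.
have: 0 < `|coord_sum R x| by rewrite normr_gt0 coord_sum_neq0.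
have -> : flip S f x = ~~ Maj n x by case: (flip S f x) (Maj n x) gx_neq => [] [].
rewrite -sgn_Maj_mul; case: (Maj n x) => /=; lra.
Qed.

(** * Points with at most one unerased coordinate *)

Definition tern1 (n : nat) (u : 'I_n * bool) : tern n :=
  [ffun j => if j == u.1 then Some u.2 else None].

Lemma tern1_inj (n : nat) : injective (@tern1 n).
Proof.
move=> [i b] [j c] /ffunP/(_ i); rewrite !ffunE eqxx /=.
by case: eqP => // -> [->].
Qed.

Lemma erasure_prob_tern1 (R : realFieldType) (n : nat) (p : R) (u : 'I_n * bool) :
  erasure_prob p (tern1 u) = p / 2 * (1 - p) ^+ n.-1.
Proof.
rewrite /erasure_prob (bigD1 u.1) //= ffunE eqxx /=; congr (_ * _).
rewrite (eq_bigr (fun=> 1 - p)); last by move=> j /negPf j_neq; rewrite ffunE j_neq.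
by rewrite prodr_const -[in RHS](card_ord n) -(cardC1 u.1).
Qed.

Lemma mlext_tern1 (R : realFieldType) (n : nat) (f : boolfun n) (u : 'I_n * bool) :
  mlext f (fun i => tern_val R (tern1 u i)) =
  fourier R f set0 + fourier R f [set u.1] * sgn R u.2.
Proof.
rewrite /mlext (bigD1 set0) //= big_set0 mulr1; congr (_ + _).
have neq0 : [set u.1] != set0 by apply/set0Pn; exists u.1; rewrite inE.
rewrite (bigD1 [set u.1]) //= big_set1 ffunE eqxx /= big1 ?addr0 //.
move=> T /andP[/set0Pn[i iT] T_neq].
(* Any remaining [T] contains an erased coordinate, which kills its monomial. *)
have [j jT j_neq] : exists2 j, j \in T & j != u.1.
  apply/exists_inP; apply: contraNT T_neq => /exists_inPn T_sub.
  have eq_u j : j \in T -> j = u.1 by move/T_sub/negPn/eqP.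
  rewrite eqEsubset sub1set -(eq_u i iT) iT andbT.
  by apply/subsetP => j jT; rewrite inE (eq_u j jT) (eq_u i iT).
by rewrite (bigD1 j) //= ffunE (negPf j_neq) /= mul0r mulr0.
Qed.

Lemma mlext_erased (R : realFieldType) (n : nat) (f : boolfun n) (z : tern n) :
  (forall i, z i = None) -> mlext f (fun i => tern_val R (z i)) = fourier R f set0.
Proof.
move=> z0; rewrite /mlext (bigD1 set0) //= big_set0 mulr1 big1 ?addr0 //.
by move=> T /set0Pn[i iT]; rewrite (bigD1 i) //= z0 mul0r mulr0.
Qed.

Lemma fourier0 (R : realFieldType) (n : nat) (f : boolfun n) :
  unbiased R f -> fourier R f set0 = 0.
Proof. by move=> <-; apply: eq_expect => x; rewrite big_set0 mulr1. Qed.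

(** * Bounds on [Phi] for small [p] *)

Lemma tern_prob_ge0 (R : realFieldType) (p : R) (t : option bool) :
  0 <= p <= 1 -> 0 <= tern_prob p t.
Proof. by case/andP=> ? ?; case: t => [b|] /=; lra. Qed.

Lemma tern_prob_le1 (R : realFieldType) (p : R) (t : option bool) :
  0 <= p <= 1 -> tern_prob p t <= 1.
Proof. by case/andP=> ? ?; case: t => [b|] /=; lra. Qed.

Lemma erasure_prob_ge0 (R : realFieldType) (n : nat) (p : R) (z : tern n) :
  0 <= p <= 1 -> 0 <= erasure_prob p z.
Proof. by move=> p01; apply: prodr_ge0 => i _; exact: tern_prob_ge0. Qed.

Lemma erasure_prob_le_sqr (R : realFieldType) (n : nat) (p : R) (z : tern n)
    (i j : 'I_n) :
  0 <= p <= 1 -> i != j -> z i -> z j -> erasure_prob p z <= p ^+ 2.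
Proof.
move=> p01 ij zi zj.
have le_p k : z k -> tern_prob p (z k) <= p.
  by case/andP: p01 => ? ?; case: (z k) => //= b _; lra.
rewrite /erasure_prob (bigD1 i) //= (bigD1 j) 1?eq_sym //= mulrA expr2.
rewrite -[leRHS]mulr1; apply: ler_pM.
- by rewrite mulr_ge0 ?tern_prob_ge0.
- by apply: prodr_ge0 => k _; exact: tern_prob_ge0.
- by apply: ler_pM; rewrite ?tern_prob_ge0 ?le_p.
by apply: prodr_ile1 => k _; rewrite tern_prob_ge0 ?tern_prob_le1.
Qed.

(** A crude constant, independent of [p], for the quadratic error term. *)
Definition mlext_mass (R : realFieldType) (n : nat) (f : boolfun n) : R :=
  \sum_(z : tern n) `|mlext f (fun i => tern_val R (z i))|.

(** With zero constant coefficient, both signs of the unerased coordinate give the same absolute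
    value, which absorbs the factor 1/2. *)
Lemma Phi_tern1 (R : realFieldType) (n : nat) (p : R) (f : boolfun n) :
  unbiased R f ->
  \sum_(z in [set tern1 u | u : 'I_n * bool])
     erasure_prob p z * `|mlext f (fun i => tern_val R (z i))| =
  p * (1 - p) ^+ n.-1 * level1_norm R f.
Proof.
move=> f_unb; rewrite big_imset /=; last by move=> u v _ _; exact: tern1_inj.
under eq_bigr => u _.
  rewrite mlext_tern1 fourier0 // add0r normrM normr_sgn mulr1 erasure_prob_tern1.
  over.
rewrite -(pair_bigA _ (fun i (_ : bool) =>
   p / 2 * (1 - p) ^+ n.-1 * `|fourier R f [set i]|)) /= mulr_sumr.
apply: eq_bigr => i _.
by rewrite big_bool /=; field.
Qed.

Lemma Phi_ge (R : realFieldType) (n : nat) (p : R) (f : boolfun n) :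
  unbiased R f -> 0 <= p <= 1 ->
  p * (1 - p) ^+ n.-1 * level1_norm R f <= Phi p f.
Proof.
move=> f_unb p01; rewrite -Phi_tern1 // /Phi.
rewrite [leRHS](bigID (mem [set tern1 u | u : 'I_n * bool])) /= lerDl.
by apply: sumr_ge0 => z _; rewrite mulr_ge0 ?erasure_prob_ge0.
Qed.

(** Outside the image of [tern1], the fully erased point contributes zero since [f] is unbiased, and
    every other point has two unerased coordinates, hence probability at most [p ^+ 2]. *)
Lemma Phi_le (R : realFieldType) (n : nat) (p : R) (f : boolfun n) :
  unbiased R f -> 0 <= p <= 1 ->
  Phi p f <= p * (1 - p) ^+ n.-1 * level1_norm R f + p ^+ 2 * mlext_mass R f.
Proof.
move=> f_unb p01; rewrite -Phi_tern1 // /Phi.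
rewrite [leLHS](bigID (mem [set tern1 u | u : 'I_n * bool])) /= lerD2l.
rewrite /mlext_mass [in leRHS](bigID (mem [set tern1 u | u : 'I_n * bool])) /=.
rewrite mulrDr -[leLHS]add0r; apply: lerD.
  by rewrite mulr_ge0 ?sumr_ge0 ?sqr_ge0.
rewrite mulr_sumr; apply: ler_sum => z z_notin.
have [/existsP[i zi]|/existsPn z0] := boolP [exists i, z i : bool]; last first.
  rewrite mlext_erased ?fourier0 ?normr0 ?mulr0 // => i.
  by case: (z i) (z0 i).
have [/existsP[j /andP[ji zj]]|/existsPn z_only] :=
    boolP [exists j, (i != j) && (z j : bool)].
  by rewrite ler_wpM2r // (erasure_prob_le_sqr p01 ji).
(* If [i] were the only unerased coordinate, [z] would lie in the image of [tern1]. *)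
case/imsetP: z_notin; case E: (z i) zi => [b|] // _.
exists (i, b); rewrite ?inE //; apply/ffunP => j; rewrite ffunE /=.
have := z_only j; rewrite eq_sym; case: eqP => [->|_] //=.
by case: (z j).
Qed.

Lemma Phi_lt_Maj_near0 (R : realFieldType) (n : nat) (f : boolfun n) :
  odd n -> unbiased R f -> (forall S, f <> flip S (Maj n)) ->
  exists2 q : R, 0 < q &
    forall p, 0 < p -> p < q -> p <= 1 / 2 -> Phi p f < Phi p (Maj n).
Proof.
move=> n_odd f_unb f_neq.
have gap := level1_norm_lt_Maj R n_odd f_neq.
have mass_ge0 : 0 <= mlext_mass R f by apply: sumr_ge0.
(* For [p <= 1 / 2], the main terms differ by at least [p * c]; the error stays below this once
   [p * mlext_mass R f < c]. *)
pose c : R := (1 / 2) ^+ n.-1 * (level1_norm R (Maj n) - level1_norm R f).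
have c_gt0 : 0 < c by rewrite mulr_gt0 ?subr_gt0 // exprn_gt0 // divr_gt0.
(* Adding 1 makes the divisor positive from nonnegativity of the mass alone. *)
have d_gt0 : 0 < mlext_mass R f + 1 by lra.
exists (c / (mlext_mass R f + 1)); first by rewrite divr_gt0.
move=> p p_gt0; rewrite ltr_pdivlMr // => p_lt p_half.
have p01 : 0 <= p <= 1 by apply/andP; split; lra.
apply: le_lt_trans (Phi_le f_unb p01) _.
apply: lt_le_trans (Phi_ge (unbiased_Maj R n_odd) p01).
have c_le : c <= (1 - p) ^+ n.-1 * (level1_norm R (Maj n) - level1_norm R f).
  rewrite /c ler_wpM2r ?subr_ge0 ?(ltW gap) //.
  by apply: lerXn2r; rewrite ?nnegrE; lra.
rewrite -ltrBrDl -mulrBr expr2 -!mulrA ltr_pM2l //.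
apply: lt_le_trans c_le; lra.
Qed.

(** The minimum of finitely many positive thresholds is positive; the default 1 covers an empty
    [T]. *)
Lemma fin_uniform_pos (R : realFieldType) (T : finType) (P : T -> R -> Prop) :
  (forall t, exists2 q, 0 < q & forall p, 0 < p -> p < q -> P t p) ->
  exists2 q, 0 < q & forall p, 0 < p -> p < q -> forall t, P t p.
Proof.
move=> exP.
have [q q_gt0 qP] := fin_all_exists2 exP.
exists (\big[Order.min/1]_t q t); first by apply/bigmin_gtP.
by move=> p p_gt0 /bigmin_gtP[_ p_lt] t; apply: qP => //; exact: p_lt.
Qed.

Theorem theorem7 (R : realFieldType) (n : nat) (n_odd : odd n) :
  unbiased R (Maj n) /\
  exists p0 : R,
    [/\ 0 < p0, p0 <= 1 &
     forall p : R, 0 < p -> p < p0 ->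
     forall f : boolfun n, unbiased R f ->
       ((forall S : {set 'I_n}, f <> flip S (Maj n)) ->
          Phi p (Maj n) > Phi p f) /\
       ((exists S : {set 'I_n}, f = flip S (Maj n)) ->
          Phi p f = Phi p (Maj n))].
Proof.
split; first exact: unbiased_Maj.
(* The hypotheses on [f] sit inside [P] so that it ranges over the whole finite type; where they
   fail, [P] is vacuous and the threshold 1 serves. *)
pose P (f : boolfun n) (p : R) := unbiased R f ->
  (forall S, f <> flip S (Maj n)) -> p <= 1 / 2 -> Phi p f < Phi p (Maj n).
have [q q_gt0 qP] : exists2 q : R, 0 < q &
    forall p, 0 < p -> p < q -> forall f, P f p.
  apply: fin_uniform_pos => f.
  have [/eqP f_unb|f_b] := boolP (expect (fun x => sgn R (f x)) == 0); last first.
    by exists 1 => // p _ _ f_unb; rewrite f_unb eqxx in f_b.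
  have [/existsP[S /eqP fS]|/existsPn f_neq] :=
      boolP [exists S, f == flip S (Maj n)].
    by exists 1 => // p _ _ _ /(_ S).
  have f_neq' S : f <> flip S (Maj n) by apply/eqP.
  have [q q_gt0 qP] := Phi_lt_Maj_near0 n_odd f_unb f_neq'.
  by exists q => // p p_gt0 p_lt _ _; exact: qP.
(* The cap 1/2 supplies the side condition of [P]. *)
exists (Order.min q (1 / 2)); split.
- by rewrite lt_min q_gt0 divr_gt0.
- by rewrite ge_min; apply/orP; right; lra.
move=> p p_gt0; rewrite lt_min => /andP[p_lt p_half] f f_unb; split.
  by move=> f_neq; apply: qP => //; exact: ltW.
by case=> S ->; exact: Phi_flip.
Qed.
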